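(* Let $\alpha\in\mathbb R\setminus\{0,1\}$. Suppose either $\lambda=\alpha$ and $\alpha\notin\mathbb N$, or $\lambda=1$ and $\alpha^{-1}\notin\mathbb N$. Then the Gelfand–Kirillov dimension of the $U(\mathfrak g)$-module $F_\lambda$ is $GK(F_\lambda)=1$.
   Context: $\mathbb N=\{0,1,2,\dots\}$. $\mathcal P(\mathbb C^{2|2})=\mathbb C[z_1,z_2]\otimes\Lambda(z_3,z_4)$, with $z_1,z_2$ even and $z_3,z_4$ odd; $\partial_i=\partial_{z_i}$ are the (left) partial superderivatives. The Bessel operators are $\mathcal B_\lambda(z_1)=(-\lambda+z_1\partial_1+z_3\partial_3+z_4\partial_4)\partial_1-2\alpha z_2\partial_3\partial_4$, $\mathcal B_\lambda(z_2)=(-\tfrac{\lambda}{\alpha}+z_2\partial_2+z_3\partial_3+z_4\partial_4)\partial_2-2z_1\partial_3\partial_4$, $\mathcal B_\lambda(z_3)=(-2\lambda+2z_1\partial_1+2\alpha z_2\partial_2+2(1+\alpha)z_3\partial_3)\partial_4+z_3\partial_1\partial_2$, $\mathcal B_\lambda(z_4)=(2\lambda-2z_1\partial_1-2\alpha z_2\partial_2-2(1+\alpha)z_4\partial_4)\partial_3+z_4\partial_1\partial_2$. $\mathcal I_\lambda$ is the ideal of $\mathcal P(\mathbb C^{2|2})$ generated by $2z_1z_2+z_3z_4,\ z_2^2,\ z_2z_3,\ z_2z_4$ if $\lambda=\alpha$, and by $2\alpha z_1z_2+z_3z_4,\ z_1^2,\ z_1z_3,\ z_1z_4$ if $\lambda=1$.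 $D_\alpha$ is the real Jordan superalgebra with even basis $e_1,e_2$, odd basis $\xi,\eta$ and supercommutative product $e_ie_i=e_i$, $e_1e_2=0$, $e_i\xi=\frac12\xi$, $e_i\eta=\frac12\eta$, $\xi\eta=e_1+\alpha e_2$. $L_a$ is left multiplication by $a$, $\mathrm{Der}(D_\alpha)$ the space of (super)derivations, $\mathfrak{str}(D_\alpha)=\{L_a\}\oplus\mathrm{Der}(D_\alpha)\subset\mathrm{End}(D_\alpha)$ with supercommutator bracket. $\mathfrak g=\mathrm{TKK}(D_\alpha)=D_\alpha^-\oplus\mathfrak{str}(D_\alpha)\oplus D_\alpha^+\ (\cong D(2,1;\alpha))$ with $D_\alpha^\pm$ copies of $D_\alpha$ (write $a^\pm$), and brackets $[L_a,x^+]=(ax)^+$, $[D,x^+]=(Dx)^+$, $[L_a,u^-]=-(au)^-$, $[D,u^-]=(Du)^-$, $[x^+,u^-]=2L_{xu}+2[L_x,L_u]$, $[D_\alpha^\pm,D_\alpha^\pm]=0$ ($D\in\mathrm{Der}(D_\alpha)$). Let $a\mapsto z_a$ be the linear map with $e_1,e_2,\xi,\eta\mapsto z_1,z_2,z_3,z_4$, extend $\mathcal B_\lambda(z_a)$ linearly in $a$, and for $T\in\mathrm{End}(D_\alpha)$ let $\partial_T$ be the superderivation of $\mathcal P(\mathbb C^{2|2})$ (of the parity of $T$) with $\partial_T(z_b)=z_{T(b)}$. Put $\pi_\lambda(L_a)=\lambda(L_a)-\partial_{L_a}$, where $\lambda(2L_{e_1})=\lambda$, $\lambda(2L_{e_2})=\lambda/\alpha$,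 $\lambda(L_\xi)=\lambda(L_\eta)=0$ (extended linearly). The Fock representation is $\rho_\lambda(a^-)=-\frac{\imath}{2}(z_a+\mathcal B_\lambda(z_a))+\imath\,\pi_\lambda(L_a)$, $\rho_\lambda(a^+)=-\frac{\imath}{2}(z_a+\mathcal B_\lambda(z_a))-\imath\,\pi_\lambda(L_a)$, $\rho_\lambda(2L_a)=z_a-\mathcal B_\lambda(z_a)$, $\rho_\lambda(D)=\partial_D$; it preserves $\mathcal I_\lambda$ and acts on $\mathcal P(\mathbb C^{2|2})/\mathcal I_\lambda$. $F_\lambda=U(\mathfrak g)1\bmod\mathcal I_\lambda$ is the submodule of $\mathcal P(\mathbb C^{2|2})/\mathcal I_\lambda$ generated by the constant $1$ (complex span). Gelfand–Kirillov dimension: for a finitely generated algebra $R$ and finitely generated $R$-module $F$, $GK(F)=\limsup_{k\to\infty}\log_k\dim(V^kF_0)$, where $V\subset R$ is a finite-dimensional subspace containing $1$ and generators of $R$ and $F_0\subset F$ is a finite-dimensional subspace generating $F$ (independent of the choices). *)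

(* Defs.v *)
From HB Require Import structures.
From mathcomp Require Export all_boot all_order all_algebra complex.
From mathcomp Require Export boolp classical_sets reals ereal sequences exp.
(* mpoly and the analysis files declare incompatible notations. *)
From mathcomp Require Export -(notations) mpoly.
From mathcomp Require Import ring.

Set Implicit Arguments.
Unset Strict Implicit.
Unset Printing Implicit Defensive.

Import Order.TTheory GRing.Theory Num.Theory.

Local Open Scope classical_set_scope.
Local Open Scope ring_scope.
Local Open Scope complex_scope.
Local Open Scope quotient_scope.

Section LmodQuotient.
Variables (K : pzRingType) (V : lmodType K) (S : submodClosed V).

Definition lquot_ker : {pred V} := S.
Fact lquot_ker_closed : zmod_closed lquot_ker.
Proof.
have [S0 linS] := submodClosedP S; split=> // x y xS yS.
by rewrite -scaleN1r addrC; apply: linS.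
Qed.
HB.instance Definition _ := GRing.isZmodClosed.Build V lquot_ker
  lquot_ker_closed.

Definition lquot : Type := Quotient.quot lquot_ker.
HB.instance Definition _ := GRing.Zmodule.on lquot.
HB.instance Definition _ := EqQuotient.on lquot.

Definition lquot_pi (x : V) : lquot := \pi_(Quotient.quot lquot_ker) x.

Lemma lquot_piE (x y : V) : lquot_pi x = lquot_pi y <-> x - y \in S.
Proof.
split; first by move=> /eqmodP; rewrite /= /Quotient.equiv.
by move=> xyS; apply/eqmodP; rewrite /= /Quotient.equiv.
Qed.

Lemma lquot_reprK (u : lquot) : lquot_pi (repr (u : (Quotient.quot lquot_ker))) = u.
Proof. exact: reprK. Qed.

Lemma lquot_piD (x y : V) : lquot_pi (x + y) = lquot_pi x + lquot_pi y.
Proof. exact: (raddfD (\pi_(Quotient.quot lquot_ker))). Qed.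

Definition lquot_scale (c : K) (u : lquot) : lquot :=
  lquot_pi (c *: repr (u : (Quotient.quot lquot_ker))).

Lemma lquot_piZ c (x : V) : lquot_pi (c *: x) = lquot_scale c (lquot_pi x).
Proof.
apply/lquot_piE; rewrite -scalerBr rpredZ //.
by apply/lquot_piE; rewrite lquot_reprK.
Qed.

Fact lquot_scaleA a b u :
  lquot_scale a (lquot_scale b u) = lquot_scale (a * b) u.
Proof. by rewrite -[u]lquot_reprK -!lquot_piZ scalerA. Qed.
Fact lquot_scale1 : left_id 1 lquot_scale.
Proof. by move=> u; rewrite -[u]lquot_reprK -lquot_piZ scale1r. Qed.
Fact lquot_scaleDr : right_distributive lquot_scale +%R.
Proof.
move=> c u v; rewrite -[u]lquot_reprK -[v]lquot_reprK -lquot_piD -!lquot_piZ.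
by rewrite scalerDr lquot_piD.
Qed.
Fact lquot_scaleDl u : {morph lquot_scale^~ u : a b / a + b}.
Proof.
by move=> a b; rewrite -[u]lquot_reprK -!lquot_piZ scalerDl lquot_piD.
Qed.

HB.instance Definition _ := GRing.Zmodule_isLmodule.Build K lquot
  lquot_scaleA lquot_scale1 lquot_scaleDr lquot_scaleDl.

End LmodQuotient.

Section FiniteDimension.
Variables (K : fieldType) (M : lmodType K).
Implicit Types W X : set M.

Definition subspace W := W 0 /\ forall c x y, W x -> W y -> W (c *: x + y).

Definition lspan X : set M :=
  [set m | exists n (c : 'I_n -> K) (v : 'I_n -> M),
    (forall i, X (v i)) /\ m = \sum_i c i *: v i].

Definition lfree n (v : 'I_n -> M) :=
  forall c : 'I_n -> K, \sum_i c i *: v i = 0 -> forall i, c i = 0.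

Definition has_ldim W (n : nat) :=
  exists v : 'I_n -> M, lfree v /\ W = lspan (range v).

Definition finite_dim W := exists n, has_ldim W n.

(* The dimension of W if W is finite-dimensional, and 0 otherwise. *)
Definition ldim W : nat := xget 0%N [set n | has_ldim W n].

End FiniteDimension.

Section GelfandKirillov.
Variables (R : realType) (K : fieldType) (A : algType K) (M : lmodType K).
Variable act : A -> M -> M.

Definition is_module :=
  [/\ forall c u v x, act (c *: u + v) x = c *: act u x + act v x,
      forall c u x y, act u (c *: x + y) = c *: act u x + act u y,
      forall x, act 1 x = x
    & forall u v x, act (u * v) x = act u (act v x)].

Definition subalgebra (B : set A) :=
  [/\ subspace B, B 1 & forall u v, B u -> B v -> B (u * v)].

Definition submodule (N : set M) :=
  subspace N /\ forall u x, N x -> N (act u x).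

Definition generates_alg (V : set A) :=
  forall B, subalgebra B -> V `<=` B -> B = setT.

Definition generates_mod (F F0 : set M) :=
  F0 `<=` F /\ forall N, submodule N -> F0 `<=` N -> F `<=` N.

Definition subspace_mul (V W : set A) : set A :=
  lspan [set w | exists u v, [/\ V u, W v & w = u * v]].

Definition subspace_pow (V : set A) (k : nat) : set A :=
  iter k (subspace_mul V) (lspan [set 1]).

Definition subspace_act (V : set A) (W : set M) : set M :=
  lspan [set x | exists u v, [/\ V u, W v & x = act u v]].

Definition gk_frame (F : set M) (V : set A) (F0 : set M) :=
  [/\ finite_dim V, V 1, generates_alg V, finite_dim F0 & generates_mod F F0].

Definition gk_growth (V : set A) (F0 : set M) : \bar R :=
  limn_esup (fun k : nat =>
    (ln (ldim (subspace_act (subspace_pow V k) F0))%:R / ln k%:R)%:E).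

(* F is a finitely generated module over the finitely generated algebra A, and
   its Gelfand-Kirillov dimension is d, whatever the choice of V and F0. *)
Definition has_GKdim (F : set M) (d : \bar R) :=
  [/\ submodule F, exists V F0, gk_frame F V F0
    & forall V F0, gk_frame F V F0 -> gk_growth V F0 = d].

End GelfandKirillov.

Section Enveloping.
Variables (R : realType) (V : lmodType R).
(* A real Lie superalgebra, given as a subspace G of V; part s is the
   projection on the component of parity s, and br the bracket. *)
Variables (G : set V) (part : bool -> V -> V) (br : V -> V -> V).

Definition is_superlie_map (A : algType R[i]) (j : V -> A) :=
  (forall (r : R) X Y, G X -> G Y -> j (r *: X + Y) = r%:C *: j X + j Y) /\
  (forall (s t : bool) X Y, G X -> G Y -> part s X = X -> part t Y = Y ->
     j X * j Y - (-1) ^+ (s && t) *: (j Y * j X) = j (br X Y)).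

(* (U, iota) is the universal enveloping algebra of the complexification of G;
   iota is only relevant on G. *)
Definition is_enveloping (U : algType R[i]) (iota : V -> U) :=
  is_superlie_map iota /\
  forall (A : algType R[i]) (j : V -> A), is_superlie_map j ->
    exists phi : {lrmorphism U -> A}, (forall X, G X -> phi (iota X) = j X) /\
      forall psi : {lrmorphism U -> A},
        (forall X, G X -> psi (iota X) = j X) -> psi =1 phi.

End Enveloping.

Section JordanTKK.
Variables (R : realType) (alpha : R).
Local Notation D := 'cV[R]_4.
Local Notation End := 'M[R]_4.
Implicit Types (a b : D) (S T : End).

Definition o1 : 'I_4 := @Ordinal 4 0 isT.
Definition o2 : 'I_4 := @Ordinal 4 1 isT.
Definition o3 : 'I_4 := @Ordinal 4 2 isT.
Definition o4 : 'I_4 := @Ordinal 4 3 isT.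

(* D_alpha, in coordinates with respect to e_1, e_2, xi, eta. *)
Definition jmul a b : D :=
  let x i := a i 0 in let y i := b i 0 in
  let w := x o3 * y o4 - x o4 * y o3 in
  let odd i := 2^-1 * ((x o1 + x o2) * y i + x i * (y o1 + y o2)) in
  \col_i [:: x o1 * y o1 + w; x o2 * y o2 + alpha * w; odd o3; odd o4]`_i.

Definition parity (i : 'I_4) : bool := (2 <= i)%N.

Definition vpart (s : bool) a : D :=
  \col_i (if parity i == s then a i 0 else 0).

Definition mpart (s : bool) T : End :=
  \matrix_(i, j) (if parity i (+) parity j == s then T i j else 0).

Definition Lmx a : End := \matrix_(i, j) jmul a (delta_mx j 0) i 0.

Definition scomm S T : End :=
  \sum_(s : bool) \sum_(t : bool)
    (mpart s S *m mpart t T - (-1) ^+ (s && t) *: (mpart t T *m mpart s S)).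

Definition superderivation T :=
  forall (s t : bool) a b, vpart t a = a ->
    mpart s T *m jmul a b =
    jmul (mpart s T *m a) b + (-1) ^+ (s && t) *: jmul a (mpart s T *m b).

Definition in_str T := exists a T', superderivation T' /\ T = Lmx a + T'.

(* If T = L_a + T' with T' a superderivation, then a = strL T and T' = strD T
   (strLK, strDK below): T' kills the unit e_1 + e_2. *)
Definition junit : D := \col_i (~~ parity i)%:R.
Definition strL T : D := T *m junit.
Definition strD T : End := T - Lmx (strL T).

Lemma mul_Lmx a b : Lmx a *m b = jmul a b.
Proof.
apply/colP => i; rewrite mxE.
under eq_bigr do rewrite !mxE.
rewrite !big_ord_recl big_ord0 !mxE.
have -> : lift ord0 ord0 = o2 by apply: val_inj.
have -> : lift ord0 (lift ord0 ord0) = o3 by apply: val_inj.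
have -> : lift ord0 (lift ord0 (lift ord0 ord0)) = o4 by apply: val_inj.
have -> : ord0 = o1 by apply: val_inj.
case: i => [[|[|[|[|//]]]] lt_i] /=; by field.
Qed.

Lemma jmul_unit a : jmul a junit = a.
Proof.
apply/colP => i; rewrite !mxE /=.
case: i => [[|[|[|[|//]]]] lt_i] /=; rewrite (bool_irrelevance lt_i isT).
- by rewrite -/o1; ring.
- by rewrite -/o2; ring.
- by rewrite -/o3; field.
- by rewrite -/o4; field.
Qed.

Lemma mul_jmul_unit a : jmul junit a = a.
Proof.
apply/colP => i; rewrite !mxE /=.
case: i => [[|[|[|[|//]]]] lt_i] /=; rewrite (bool_irrelevance lt_i isT).
- by rewrite -/o1; ring.
- by rewrite -/o2; ring.
- by rewrite -/o3; field.
- by rewrite -/o4; field.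
Qed.

Lemma strLK a T : superderivation T -> strL (Lmx a + T) = a.
Proof.
move=> derT; rewrite /strL mulmxDl mul_Lmx jmul_unit.
have killT s : mpart s T *m junit = 0.
  have u0 : vpart false junit = junit.
    by apply/colP => i; rewrite !mxE; case: (parity i).
  have := derT s false junit junit u0.
  rewrite !jmul_unit mul_jmul_unit andbF expr0 scale1r.
  by move/eqP; rewrite -subr_eq0 opprD addNKr oppr_eq0 => /eqP.
have -> : T = mpart false T + mpart true T.
  apply/matrixP => i j; rewrite !mxE.
  by case: (parity i (+) parity j); rewrite /= ?add0r ?addr0.
by rewrite mulmxDl !killT !addr0.
Qed.

Lemma strDK a T : superderivation T -> strD (Lmx a + T) = T.
Proof. by move=> derT; rewrite /strD strLK // addrC addKr. Qed.

(* D_alpha^- (+) End(D_alpha) (+) D_alpha^+, in which TKK(D_alpha) is the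
   subspace in_tkk; (u, T, x) stands for u^- + T + x^+. *)
Definition tkk : Type := (D * End * D)%type.
HB.instance Definition _ := GRing.Lmodule.on tkk.
Implicit Types X Y : tkk.

Definition in_tkk : set tkk := [set X | in_str X.1.2].

Definition tkk_part (s : bool) X : tkk :=
  (vpart s X.1.1, mpart s X.1.2, vpart s X.2).

(* The brackets [T, v^-], [x^+, v^-] and [T, y^+]; the bracket of tkk is their
   super-antisymmetrization plus the supercommutator of str(D_alpha). *)
Definition tkk_half X Y : tkk :=
  let: (_, T, x) := X in let: (v, _, y) := Y in
  (- jmul (strL T) v + strD T *m v,
   2 *: Lmx (jmul x v) + 2 *: scomm (Lmx x) (Lmx v),
   T *m y).

Definition tkk_br X Y : tkk :=
  (0, scomm X.1.2 Y.1.2, 0) +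
  \sum_(s : bool) \sum_(t : bool)
    (tkk_half (tkk_part s X) (tkk_part t Y)
     - (-1) ^+ (s && t) *: tkk_half (tkk_part t Y) (tkk_part s X)).

End JordanTKK.

Section SuperPolynomials.
Variable R : realType.
Local Notation C := R[i].
Local Notation A := (mpoly 2 C).

(* C[z1, z2] (x) /\(z3, z4): ((f0, f3), f4), f34) stands for
   f0 + f3 z3 + f4 z4 + f34 z3 z4. *)
Definition spoly : Type := (A * A * A * A)%type.
HB.instance Definition _ := GRing.Lmodule.on spoly.
Implicit Types p q : spoly.

Definition smul p q : spoly :=
  let: (f0, f3, f4, f34) := p in let: (g0, g3, g4, g34) := q in
  (f0 * g0, f0 * g3 + f3 * g0, f0 * g4 + f4 * g0,
   f0 * g34 + f34 * g0 + f3 * g4 - f4 * g3).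

Definition sone : spoly := (1, 0, 0, 0).

Definition zgen (i : 'I_4) : spoly :=
  match val i with
  | 0 => (mpolyX _ (mnm1 ord0), 0, 0, 0)
  | 1 => (mpolyX _ (mnm1 ord_max), 0, 0, 0)
  | 2 => (0, 1, 0, 0)
  | _ => (0, 0, 1, 0)
  end.

Definition zmul (i : 'I_4) p : spoly := smul (zgen i) p.

Definition sderiv (i : 'I_4) p : spoly :=
  let: (f0, f3, f4, f34) := p in
  match val i with
  | 0 => (mderiv ord0 f0, mderiv ord0 f3, mderiv ord0 f4, mderiv ord0 f34)
  | 1 => (mderiv ord_max f0, mderiv ord_max f3, mderiv ord_max f4,
          mderiv ord_max f34)
  | 2 => (f3, 0, f34, 0)
  | _ => (f4, - f34, 0, 0)
  end.

(* The superderivation with z_b |-> z_(T b): with left derivatives, it is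
   \sum_j z_(T e_j) d_j. *)
Definition pder (T : 'M[R]_4) p : spoly :=
  \sum_j \sum_i (T i j)%:C *: zmul i (sderiv j p).

Variables alpha lambda : R.

Local Notation z1 := (zmul o1).
Local Notation z2 := (zmul o2).
Local Notation z3 := (zmul o3).
Local Notation z4 := (zmul o4).
Local Notation d1 := (sderiv o1).
Local Notation d2 := (sderiv o2).
Local Notation d3 := (sderiv o3).
Local Notation d4 := (sderiv o4).

Definition bessel (i : 'I_4) p : spoly :=
  match val i with
  | 0 => let q := d1 p in
      - lambda%:C *: q + z1 (d1 q) + z3 (d3 q) + z4 (d4 q)
      - (2 * alpha)%:C *: z2 (d3 (d4 p))
  | 1 => let q := d2 p in
      - (lambda / alpha)%:C *: q + z2 (d2 q) + z3 (d3 q) + z4 (d4 q)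
      - 2 *: z1 (d3 (d4 p))
  | 2 => let q := d4 p in
      - (2 * lambda)%:C *: q + 2 *: z1 (d1 q) + (2 * alpha)%:C *: z2 (d2 q)
      + (2 * (1 + alpha))%:C *: z3 (d3 q) + z3 (d1 (d2 p))
  | _ => let q := d3 p in
      (2 * lambda)%:C *: q - 2 *: z1 (d1 q) - (2 * alpha)%:C *: z2 (d2 q)
      - (2 * (1 + alpha))%:C *: z4 (d4 q) + z4 (d1 (d2 p))
  end.

Implicit Types a : 'cV[R]_4.

Definition zvec a p : spoly := \sum_i (a i 0)%:C *: zmul i p.
Definition besselv a p : spoly := \sum_i (a i 0)%:C *: bessel i p.

Definition lambdaL a : R :=
  lambda / 2 * a o1 0 + lambda / (2 * alpha) * a o2 0.

Definition piL a p : spoly := (lambdaL a)%:C *: p - pder (Lmx alpha a) p.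

Definition fock_minus a p : spoly :=
  - ('i%C / 2) *: (zvec a p + besselv a p) + 'i%C *: piL a p.
Definition fock_plus a p : spoly :=
  - ('i%C / 2) *: (zvec a p + besselv a p) - 'i%C *: piL a p.
Definition fock_L a p : spoly := 2^-1 *: (zvec a p - besselv a p).

Definition fock (X : tkk R) p : spoly :=
  let: (u, T, x) := X in
  fock_minus u p + fock_L (strL T) p + pder (strD alpha T) p + fock_plus x p.

Definition sideal (J : set spoly) :=
  subspace J /\ forall p q, J p -> J (smul q p) /\ J (smul p q).

Definition fock_gens : seq spoly :=
  let g1 := zgen o1 in let g2 := zgen o2 in
  let g3 := zgen o3 in let g4 := zgen o4 in
  if lambda == alpha then
    [:: 2 *: smul g1 g2 + smul g3 g4; smul g2 g2; smul g2 g3; smul g2 g4]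
  else if lambda == 1 then
    [:: (2 * alpha)%:C *: smul g1 g2 + smul g3 g4;
        smul g1 g1; smul g1 g3; smul g1 g4]
  else [::].

Definition fock_ideal : {pred spoly} := fun p =>
  `[< forall J, sideal J -> [set` fock_gens] `<=` J -> J p >].

Fact fock_ideal_submod : submod_closed fock_ideal.
Proof.
split=> [|c p q /asboolP pI /asboolP qI]; apply/asboolP => J idJ gJ.
  by case: idJ => -[].
by case: (idJ) => -[_ linJ] _; apply: linJ; [apply: pI|apply: qI].
Qed.
HB.instance Definition _ := GRing.isSubmodClosed.Build C spoly fock_ideal
  fock_ideal_submod.

Definition fock_space : lmodType C := lquot fock_ideal.

Definition fock_class (p : spoly) : fock_space := lquot_pi fock_ideal p.

End SuperPolynomials.

Arguments is_superlie_map {R V} G part br {A} j.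
Arguments is_enveloping {R V} G part br {U} iota.

(* Main.v *)
From HB Require Import structures.
From mathcomp Require Import vector topology normedtype ring.
Require Import Defs.

Set Implicit Arguments.
Unset Strict Implicit.
Unset Printing Implicit Defensive.

Import Order.TTheory GRing.Theory Num.Theory.
Import numFieldNormedType.Exports.
Local Open Scope classical_set_scope.
Local Open Scope ring_scope.

(** The number lambda singles out one of the two even variables: z_i survives
    in the quotient by the Fock ideal and z_j is nilpotent, where (i, j) is
    (1, 2) if lambda = alpha and (2, 1) if lambda = 1.  The module F therefore
    has the size of a polynomial ring in one variable, and both bounds on its
    growth follow from this without any description of F.

    Upper bound.  All the operators of the Fock representation raise the degree
    of a superpolynomial by at most one ([spoly_low_fock]).  As the enveloping
    algebra is generated by the Lie superalgebra ([enveloping_generated]), any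
    of its elements shifts the degree filtration by a bounded amount.  The
    n-th step of the filtration has dimension at most 8 (n + 1) modulo the
    ideal, because z_j ^ 2 lies in the ideal ([fock_filtration_dim]).  So the
    dimension of V^k F0 is bounded by a linear function of k.

    Lower bound.  If V^k F0 = V^(k+1) F0 for some k then V^k F0 is stable under
    the algebra generated by V, that is, under everything, so that it contains
    F.  Hence if F is infinite-dimensional then dim V^k F0 increases strictly
    with k and is at least k ([gk_growth_linear] combines the two bounds).

    F is infinite-dimensional: multiplication by z_a is the combination
    rho(L_a) + i/2 (rho(a^-) + rho(a^+)) ([zvec_fock]), so F contains the powers
    of z_i, and these are linearly independent modulo the ideal since the
    restriction of the body of a superpolynomial to the axis of z_i kills the
    ideal ([powers_lfree]). *)

(** * Dimension of subspaces given as sets *)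

Section LinearSpan.
Variables (K : fieldType) (M : lmodType K).
Implicit Types W X Y : set M.

Lemma subspaceZ W c x : subspace W -> W x -> W (c *: x).
Proof. by move=> [W0 WL] Wx; rewrite -[_ *: _]addr0; apply: WL. Qed.

Lemma subspaceD W x y : subspace W -> W x -> W y -> W (x + y).
Proof. by move=> [W0 WL] Wx; rewrite -[x in x + y]scale1r; apply: WL. Qed.

Lemma subspace_sum W (I : Type) (r : seq I) (P : pred I) (F : I -> M) :
  subspace W -> (forall i, P i -> W (F i)) -> W (\sum_(i <- r | P i) F i).
Proof.
move=> sW WF; apply: big_ind => // [|x y]; first exact: sW.1.
exact: subspaceD.
Qed.

Lemma lspan_incl X : X `<=` lspan X.
Proof.
move=> x Xx; exists 1%N, (fun=> 1), (fun=> x); split=> //.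
by rewrite big_ord1 scale1r.
Qed.

Lemma subspace_lspan X : subspace (lspan X).
Proof.
split.
  by exists 0%N, (fun=> 0), (fun=> 0); split=> [[]|] //; rewrite big_ord0.
move=> c x y [m [a [v [Xv ->]]]] [n [b [w [Xw ->]]]].
exists (m + n)%N,
  (fun i => match split i with inl j => c * a j | inr j => b j end),
  (fun i => match split i with inl j => v j | inr j => w j end).
split; first by move=> i; case: (split i).
rewrite big_split_ord scaler_sumr /=; congr (_ + _); apply: eq_bigr => i _.
  by rewrite -[lshift n i]/(unsplit (inl _ i)) unsplitK scalerA.
by rewrite -[rshift m i]/(unsplit (inr _ i)) unsplitK.
Qed.

Lemma lspan_min X W : subspace W -> X `<=` W -> lspan X `<=` W.
Proof.
move=> sW XW x [n [c [v [Xv ->]]]].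
by apply: subspace_sum => // i _; apply: subspaceZ => //; apply: XW.
Qed.

Lemma lspan_rangeP n (v : 'I_n -> M) x :
  lspan (range v) x -> exists c : 'I_n -> K, x = \sum_i c i *: v i.
Proof.
pose S : set M := [set x | exists c : 'I_n -> K, x = \sum_i c i *: v i].
have sS : subspace S.
  split; first by exists (fun=> 0); rewrite big1 // => i _; rewrite scale0r.
  move=> c _ _ [a ->] [b ->]; exists (fun i => c * a i + b i).
  rewrite scaler_sumr -big_split; apply: eq_bigr => i _ /=.
  by rewrite scalerDl scalerA.
apply: (lspan_min sS) => _ [i _ <-]; exists (fun j => (j == i)%:R).
rewrite (bigD1 i) //= eqxx scale1r big1 ?addr0 // => j /negPf->.
by rewrite scale0r.
Qed.

Lemma lspan_range_sum n (v : 'I_n -> M) (c : 'I_n -> K) :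
  lspan (range v) (\sum_i c i *: v i).
Proof.
apply: subspace_sum => [|i _]; first exact: subspace_lspan.
by apply: subspaceZ; [apply: subspace_lspan|apply: lspan_incl; exists i].
Qed.

(** Steinitz: when m > n, the m x n matrix of the coordinates of the v i on the
    w j has a nonzero row kernel, which is a linear relation between the v i. *)
Lemma lfree_leq m n (v : 'I_m -> M) (w : 'I_n -> M) :
  lfree v -> range v `<=` lspan (range w) -> (m <= n)%N.
Proof.
move=> fv vw; rewrite leqNgt; apply/negP => ltnm.
have /choice [a av] : forall i, exists c : 'I_n -> K, v i = \sum_j c j *: w j.
  by move=> i; apply: lspan_rangeP; apply: vw; exists i.
pose A := \matrix_(i, j) a i j.
have : kermx A != 0.
  by rewrite kermx_eq0 /row_free neq_ltn (leq_ltn_trans (rank_leq_col A)).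
case/rowV0Pn => u /sub_kermxP uA0 /negP[]; apply/eqP/rowP => i; rewrite mxE.
apply: (fv (u 0)).
under eq_bigr do rewrite av scaler_sumr.
rewrite exchange_big big1 //= => j _.
under eq_bigr do rewrite scalerA.
rewrite -scaler_suml; have /rowP/(_ j) := uA0; rewrite !mxE.
by under eq_bigr do rewrite mxE; move=> ->; rewrite scale0r.
Qed.

Lemma lfree_extend n (v : 'I_n -> M) x : lfree v -> ~ lspan (range v) x ->
  lfree (fun i : 'I_n.+1 => oapp v x (unlift ord0 i)).
Proof.
move=> fv xv c; rewrite big_ord_recl unlift_none /=.
under eq_bigr do rewrite liftK /=.
move=> sum0; have c0 : c ord0 = 0.
  apply/eqP/negP => /negP c0; apply: xv.
  have -> : x = \sum_i (- (c ord0)^-1 * c (lift ord0 i)) *: v i.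
    under eq_bigr do rewrite -scalerA.
    rewrite -scaler_sumr; move/eqP: sum0; rewrite addrC addr_eq0 => /eqP->.
    by rewrite scalerN scaleNr opprK scalerA mulVf // scale1r.
  exact: lspan_range_sum.
move: sum0; rewrite c0 scale0r add0r => /fv cl i.
by case: (unliftP ord0 i) => [j ->|->].
Qed.

Lemma has_ldim_leq m n W X : has_ldim W m -> has_ldim X n -> W `<=` X ->
  (m <= n)%N.
Proof.
move=> [v [fv ->]] [w [_ ->]] vw; apply: lfree_leq fv _ => x vx.
by apply: vw; apply: lspan_incl.
Qed.

Lemma ldimE n W : has_ldim W n -> ldim W = n.
Proof.
move=> Wn; rewrite /ldim; case: xgetP => [m -> Wm|/(_ n)//].
by apply/eqP; rewrite eqn_leq !(has_ldim_leq (W := W) (X := W)).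
Qed.

Lemma has_ldim_ldim W : finite_dim W -> has_ldim W (ldim W).
Proof. by move=> [n Wn]; rewrite (ldimE Wn). Qed.

(** A free family in W of maximal length spans W, as it cannot be extended; the
    length is bounded by [lfree_leq]. *)
Lemma subspace_finite_dim W n (w : 'I_n -> M) :
  subspace W -> W `<=` lspan (range w) -> finite_dim W /\ (ldim W <= n)%N.
Proof.
move=> sW Ww.
pose P m := `[< exists v : 'I_m -> M, lfree v /\ range v `<=` W >].
have exP : exists m, P m.
  exists 0%N; apply/asboolP; exists (fun=> 0).
  by split=> [? _ []//|x [[]]//].
have ubP m : P m -> (m <= n)%N.
  move=> /asboolP[v [fv vW]]; apply: lfree_leq fv _.
  exact: subset_trans vW Ww.
case: (ex_maxnP exP ubP) => m /asboolP[v [fv vW]] maxm.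
have Wm : has_ldim W m.
  exists v; split=> //; apply/seteqP; split; last exact: lspan_min.
  apply: contrapT => /existsNP[x] /not_implyP[Wx xv].
  have := maxm m.+1; rewrite ltnn; suff -> : P m.+1 by move/(_ isT).
  apply/asboolP; exists (fun i : 'I_m.+1 => oapp v x (unlift ord0 i)).
  split; first exact: lfree_extend.
  by move=> _ [i _ <-]; case: unlift => //= j; apply: vW; exists j.
split; first by exists m.
by rewrite (ldimE Wm) ubP //; apply/asboolP; exists v.
Qed.

Lemma subspace_finite_dim_fin W (T : finType) (w : T -> M) :
  subspace W -> W `<=` lspan (range w) ->
  finite_dim W /\ (ldim W <= #|T|)%N.
Proof.
move=> sW Ww; apply: (subspace_finite_dim (w := w \o enum_val)) => //.
apply: subset_trans Ww _; apply: lspan_min; first exact: subspace_lspan.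
move=> _ [t _ <-]; apply: lspan_incl; exists (enum_rank t) => //.
by rewrite /= enum_rankK.
Qed.

Lemma finite_dim_lspan n (w : 'I_n -> M) : finite_dim (lspan (range w)).
Proof.
exact: (subspace_finite_dim (subspace_lspan (range w)) (@subset_refl _ _)).1.
Qed.

Lemma finite_dim_sub W X : subspace W -> finite_dim X -> W `<=` X ->
  finite_dim W /\ (ldim W <= ldim X)%N.
Proof.
move=> sW fX WX; have [v [_ defX]] := has_ldim_ldim fX.
by apply: (subspace_finite_dim (w := v)) => //; rewrite -defX.
Qed.

Lemma ldim_proper W X : finite_dim W -> finite_dim X -> W `<=` X -> W <> X ->
  (ldim W < ldim X)%N.
Proof.
move=> fW fX WX neqWX.
have [v [fv defW]] := has_ldim_ldim fW; have [w [_ defX]] := has_ldim_ldim fX.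
have [x Xx nWx] : exists2 x, X x & ~ W x.
  apply: contrapT => noX; apply: neqWX; apply/seteqP; split=> // x Xx.
  by apply: contrapT => nWx; apply: noX; exists x.
have nvx : ~ lspan (range v) x by rewrite -defW.
apply: (lfree_leq (lfree_extend fv nvx) (w := w)); rewrite -defX.
move=> _ [i _ <-]; case: unlift => //= j.
by apply: WX; rewrite defW; apply: lspan_incl; exists j.
Qed.

(** Each of the finitely many vectors of a basis lies in some member of the
    chain, and the largest of these members contains them all.  This turns
    bounds that depend on a vector into uniform ones. *)
Lemma finite_dim_sub_chain W (S : nat -> set M) :
  finite_dim W -> (forall n, subspace (S n)) ->
  (forall m n, (m <= n)%N -> S m `<=` S n) ->
  (forall x, W x -> exists n, S n x) -> exists n, W `<=` S n.
Proof.
move=> [m [v [_ ->]]] sS incS WS.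
have /choice [d Sd] : forall i, exists n, S n (v i).
  by move=> i; apply: WS; apply: lspan_incl; exists i.
exists (\max_i d i)%N; apply: lspan_min => // _ [i _ <-].
by apply: incS (Sd i); apply: leq_bigmax.
Qed.

End LinearSpan.

(** Provides a finite basis of the Lie superalgebra, which is only given as a
    subset of a space of triples of matrices. *)
Lemma vect_finite_dim (K : fieldType) (T : vectType K) (W : set T) :
  subspace W -> finite_dim W.
Proof.
move=> sW; pose w (i : 'I_(\dim {: T})) : T := (vbasis {: T})`_i.
apply: (subspace_finite_dim (w := w) sW _).1 => x _.
rewrite (coord_vbasis (memvf x)); exact: lspan_range_sum.
Qed.

(** * Linear growth *)

(** The logarithms differ by at most ln c, which is negligible compared with
    ln k. *)
Lemma ln_ratio_limn_esup (R : realType) (u : nat -> nat) (c : nat) :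
  (forall k, (k <= u k)%N) -> (forall k, (0 < k)%N -> (u k <= c * k)%N) ->
  limn_esup (fun k : nat => (ln (u k)%:R / ln k%:R : R)%:E) = 1%:E.
Proof.
move=> le_ku le_uck.
have c_gt0 : (0 < c)%N.
  case: c le_uck => // /(_ 1%N isT); have := le_ku 1%N.
  by rewrite mul0n; case: (u 1%N).
have lny : (ln k%:R : R) @[k --> \oo] --> +oo.
  apply/cvgryPge => A; near=> k.
  rewrite -[A]expRK ler_ln ?posrE ?expR_gt0 //; last first.
    by rewrite ltr0n; near: k; exact: nbhs_infty_gt.
  by near: k; exact: nbhs_infty_ger.
have lnV0 : (ln k%:R : R)^-1 @[k --> \oo] --> (0 : R).
  apply/gtr0_cvgV0 => //; near=> k; apply: ln_gt0.
  by rewrite ltr1n; near: k; exact: nbhs_infty_gt.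
have ratio1 : (1 + ln c%:R / ln k%:R : R) @[k --> \oo] --> (1 : R).
  rewrite -[X in _ --> X]addr0; apply: cvgD; first exact: cvg_cst.
  rewrite -[X in _ --> X](mulr0 (ln c%:R)).
  by apply: cvgM; [exact: cvg_cst|exact: lnV0].
apply: (cvg_limn_einf_sup _).2; apply: cvg_EFin; first by near=> k.
apply: (@squeeze_cvgr _ _ _ _ (fun=> 1)); [|exact: cvg_cst|exact: ratio1].
near=> k.
have k2 : (1 < k)%N by near: k; exact: nbhs_infty_gt.
have k0 : (0 < k)%N by apply: ltnW.
have lnk : 0 < ln k%:R :> R by rewrite ln_gt0 // ltr1n.
have uk0 : (0 < u k)%N by apply: leq_trans (le_ku k).
apply/andP; split.
  by rewrite ler_pdivlMr // mul1r ler_ln ?posrE ?ltr0n // ler_nat.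
rewrite ler_pdivrMr // mulrDl mul1r mulfVK ?gt_eqF // addrC.
rewrite -lnM ?posrE ?ltr0n // ler_ln ?posrE ?ltr0n //; last first.
  by rewrite mulr_gt0 ?ltr0n.
by rewrite -natrM ler_nat le_uck.
Unshelve. all: by end_near.
Qed.

Section Growth.
Variables (R : realType) (K : fieldType) (A : algType K) (M : lmodType K).
Variable act : A -> M -> M.
Hypothesis hact : is_module act.
Implicit Types (V B : set A) (F N S : set M) (u : A) (x : M).

Lemma actDl c u v x : act (c *: u + v) x = c *: act u x + act v x.
Proof. by case: hact. Qed.

Lemma actDr c u x y : act u (c *: x + y) = c *: act u x + act u y.
Proof. by case: hact. Qed.

Lemma act1 x : act 1 x = x.
Proof. by case: hact. Qed.

Lemma actM u v x : act (u * v) x = act u (act v x).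
Proof. by case: hact. Qed.

Lemma act0 u : act u 0 = 0.
Proof. by have := actDr (-1) u 0 0; rewrite !scaleN1r !addNr. Qed.

Lemma act0l x : act 0 x = 0.
Proof. by have := actDl (-1) 0 0 x; rewrite !scaleN1r !addNr. Qed.

Lemma subspace_preim_act u N : subspace N -> subspace [set x | N (act u x)].
Proof.
move=> [N0 NL]; split=> [|c x y /= Nx Ny] /=; first by rewrite act0.
by rewrite actDr; apply: NL.
Qed.

Lemma subspace_preim_actl S N : subspace N ->
  subspace [set u | forall x, S x -> N (act u x)].
Proof.
move=> [N0 NL]; split=> [x _|c u v Nu Nv x Sx] /=; first by rewrite act0l.
by rewrite actDl; apply: NL; [apply: Nu|apply: Nv].
Qed.

(** The elements of the algebra that map N into N form a subalgebra. *)
Lemma generates_alg_stable V N : generates_alg V -> subspace N ->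
  (forall u x, V u -> N x -> N (act u x)) -> submodule act N.
Proof.
move=> genV sN VN; split=> // u x Nx.
pose B : set A := [set u | forall x, N x -> N (act u x)].
suff BT : B = setT.
  have Bu : B u by rewrite BT.
  exact: Bu.
apply: genV => [|v Vv]; last by move=> y; apply: VN.
split; first exact: subspace_preim_actl.
  by move=> y; rewrite act1.
by move=> v w Bv Bw y Ny; rewrite actM; apply/Bv/Bw.
Qed.

Lemma submodule_orbit x : submodule act (range (act^~ x)).
Proof.
split; last by move=> u _ [v _ <-]; exists (u * v) => //; rewrite actM.
split; first by exists 0 => //; rewrite act0l.
by move=> c _ _ [u _ <-] [v _ <-]; exists (c *: u + v) => //; rewrite actDl.
Qed.

Variables (W : nat -> set M) (c : nat) (X : set A).
Hypothesis genX : generates_alg X.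
Hypothesis sW : forall n, subspace (W n).
Hypothesis incW : forall m n, (m <= n)%N -> W m `<=` W n.
Hypothesis exhW : forall x, exists n, W n x.
Hypothesis dimW : forall n, finite_dim (W n) /\ (ldim (W n) <= c * n.+1)%N.
Hypothesis XW : forall u n x, X u -> W n x -> W n.+1 (act u x).

Definition shift d : set A :=
  [set u | forall n x, W n x -> W (n + d) (act u x)].

Lemma subspace_shift d : subspace (shift d).
Proof.
split=> [n x _|k u v su sv n x Wx]; first by rewrite act0l; apply: (sW _).1.
by rewrite actDl; apply: (sW _).2; [apply: su|apply: sv].
Qed.

Lemma shift_inc m n : (m <= n)%N -> shift m `<=` shift n.
Proof.
by move=> lemn u su k x Wx; apply: (incW _ (su k x Wx)); rewrite leq_add2l.
Qed.

Lemma shiftM d e u v : shift d u -> shift e v -> shift (e + d) (u * v).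
Proof. by move=> su sv n x Wx; rewrite actM addnA; apply/su/sv. Qed.

(** The elements having a shift form a subalgebra, and the generators in X have
    shift 1. *)
Lemma shift_exists u : exists d, shift d u.
Proof.
pose B : set A := [set u | exists d, shift d u].
suff BT : B = setT.
  by have : B u by rewrite BT.
apply: genX => [|v Xv]; last by exists 1%N => n x Wx; rewrite addn1; apply: XW.
split; first 1 last.
- by exists 0%N => n x Wx; rewrite act1 addn0.
- by move=> v w [d sd] [e se]; exists (e + d)%N; apply: shiftM.
split; first by exists 0%N; apply: (subspace_shift _).1.
move=> k v w [d sd] [e se]; exists (maxn d e).
apply: (subspace_shift _).2; [move: sd|move: se]; apply: shift_inc.
  exact: leq_maxl.
exact: leq_maxr.
Qed.

(** Only the generators in X are assumed to shift the filtration by one; the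
    frame V, F0 is arbitrary.  Uniform shifts for V and a uniform level for F0
    give the upper bound, strict growth until stabilization the lower bound. *)
Lemma gk_growth_linear V F F0 : submodule act F -> ~ finite_dim F ->
  gk_frame act F V F0 -> gk_growth R act V F0 = 1%:E.
Proof.
move=> sF infF [fdV V1 genV fdF0 [F0F genF0]].
pose E k := subspace_act act (subspace_pow V k) F0.
have sE k : subspace (E k) by apply: subspace_lspan.
have F0E : F0 `<=` E 0%N.
  move=> x Fx; apply: lspan_incl; exists 1, x; split=> //; last by rewrite act1.
  exact: lspan_incl.
have EV k u x : V u -> E k x -> E k.+1 (act u x).
  move=> Vu; move: x.
  apply: (lspan_min (subspace_preim_act u (sE k.+1))) => _ [v [y [pv Fy ->]]].
  apply: lspan_incl; exists (u * v), y; split; rewrite ?actM //.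
  by apply: lspan_incl; exists u, v.
have Einc k : E k `<=` E k.+1 by move=> x Ex; rewrite -[x]act1; apply: EV.
have [d Vd] : exists d, V `<=` shift d.
  apply: finite_dim_sub_chain => //; first exact: subspace_shift.
    exact: shift_inc.
  by move=> u _; apply: shift_exists.
have [e F0e] : exists e, F0 `<=` W e by apply: finite_dim_sub_chain.
have powV k : subspace_pow V k `<=` shift (k * d).
  elim: k => [|k IH].
    apply: lspan_min; first exact: subspace_shift.
    by move=> _ -> n x Wx; rewrite act1 mul0n addn0.
  apply: lspan_min; first exact: subspace_shift.
  move=> _ [u [v [Vu pv ->]]]; rewrite mulSn addnC; apply: shiftM.
    exact: Vd.
  exact: IH.
have EW k : E k `<=` W (e + k * d)%N.
  apply: lspan_min => // _ [u [x [pu Fx ->]]].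
  by apply: powV pu _ _ _; apply: F0e.
have dimE k : finite_dim (E k) /\ (ldim (E k) <= c * (e + k * d).+1)%N.
  have [fdW leW] := dimW (e + k * d)%N.
  have [fdE leE] := finite_dim_sub (sE k) fdW (EW k).
  by split=> //; apply: leq_trans leE leW.
(* If E k = E k.+1 then E k is a submodule that contains the generators F0,
   so F would be a subspace of the finite-dimensional space E k. *)
have ltE k : (ldim (E k) < ldim (E k.+1))%N.
  apply: ldim_proper; [exact: (dimE k).1|exact: (dimE k.+1).1|exact: Einc|].
  move=> eqE; apply: infF.
  have stabE : submodule act (E k).
    apply: (generates_alg_stable genV) => // u x Vu Ex.
    by rewrite eqE; apply: EV.
  have F0Ek : F0 `<=` E k.
    by elim: k {eqE stabE} => // k IH; apply: subset_trans IH (Einc k).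
  exact: (finite_dim_sub sF.1 (dimE k).1 (genF0 _ stabE F0Ek)).1.
apply: (@ln_ratio_limn_esup _ _ (c * (e + d).+1)%N) => k.
  by elim: k => // k IH; apply: leq_ltn_trans IH (ltE k).
move=> k0; apply: leq_trans (dimE k).2 _; rewrite -mulnA leq_mul2l.
apply/orP; right; rewrite mulSn mulnDl [(d * k)%N]mulnC.
rewrite -[in X in (X <= _)%N]add1n.
by apply: leq_add => //; rewrite leq_add2r leq_pmulr.
Qed.

End Growth.

(** * The enveloping algebra is generated by the Lie superalgebra *)

Section Subalgebra.
Variables (K : fieldType) (A : algType K) (B : set A).
Hypothesis algB : subalgebra B.

(** The proof that B is a subalgebra is an argument so that the closure
    properties can be attached to the predicate as canonical structures. *)
Definition subalg_pred (_ : subalgebra B) : {pred A} := fun u => `[< B u >].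

Fact subalg_pred_closed : subalg_closed (subalg_pred algB).
Proof.
case: (algB) => sB B1 BM; split; first exact/asboolP.
  by move=> c u v /asboolP Bu /asboolP Bv; apply/asboolP/sB.2.
by move=> u v /asboolP Bu /asboolP Bv; apply/asboolP/BM.
Qed.
HB.instance Definition _ := GRing.isSubalgClosed.Build K A (subalg_pred algB)
  subalg_pred_closed.

Record subalg_type : Type :=
  SubalgType { subalg_val : A; _ : subalg_val \in subalg_pred algB }.

HB.instance Definition _ := [isSub for subalg_val].
HB.instance Definition _ := [Choice of subalg_type by <:].
HB.instance Definition _ := [SubChoice_isSubAlgebra of subalg_type by <:].

Definition subalg_incl (x : subalg_type) : A := \val x.

Fact subalg_incl_linear : linear subalg_incl.
Proof. by move=> c x y; rewrite /subalg_incl linearP. Qed.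
Fact subalg_incl_monoid : monoid_morphism subalg_incl.
Proof. by split=> [|x y]; rewrite /subalg_incl ?rmorph1 ?rmorphM. Qed.
HB.instance Definition _ := GRing.isLinear.Build K subalg_type A *:%R
  subalg_incl subalg_incl_linear.
HB.instance Definition _ := GRing.isMonoidMorphism.Build subalg_type A
  subalg_incl subalg_incl_monoid.

End Subalgebra.

Section EnvelopingGenerated.
Variables (R : realType) (V : lmodType R).
Variables (G : set V) (part : bool -> V -> V) (br : V -> V -> V).
Variables (U : algType R[i]) (iota : V -> U).
Hypothesis hU : is_enveloping G part br iota.

(** If the subalgebra B contains the image of iota, then iota corestricts to B
    and the universal property yields a morphism from U to B.  Followed by the
    inclusion of B, it is an endomorphism of U that fixes iota, hence it is the
    identity by uniqueness. *)
Lemma enveloping_generated : generates_alg (iota @` G).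
Proof.
move=> B algB GB.
have [[iotaL iotaB] univ] := hU.
have [sB B1 BM] := algB.
pose SB := subalg_type algB.
(* The default value 0 is only taken outside G, where iota is arbitrary; the
   bracket of homogeneous elements of G is mapped into B because iota turns it
   into a supercommutator. *)
pose j X : SB := insubd 0 (iota X).
have jE X : B (iota X) -> subalg_val (j X) = iota X.
  by move=> BX; rewrite -[LHS]/(\val (j X)) /j insubdK //; apply/asboolP.
have jG X : G X -> subalg_val (j X) = iota X.
  by move=> GX; apply/jE/GB; exists X.
have Gi X : G X -> B (iota X) by move=> GX; apply: GB; exists X.
have [|phi [phij _]] := univ SB j.
  split=> [r X Y GX GY|s t X Y GX GY pX pY]; apply: val_inj.
    rewrite -[LHS]/(subalg_val (j _)) raddfD /= (jG X GX) (jG Y GY) jE iotaL //.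
    by apply: sB.2; apply: Gi.
  have Bbr : B (iota (br X Y)).
    rewrite -(iotaB s t) // -scaleNr addrC; apply: sB.2; apply: BM; exact: Gi.
  rewrite raddfB /= (jE _ Bbr) -(iotaB s t) // -!jG //.
have [phi0 [_ uniq0]] := univ U iota (conj iotaL iotaB).
apply/seteqP; split=> // u _.
pose psi : {lrmorphism U -> U} := @subalg_incl _ _ _ algB \o phi.
have psiE : psi =1 phi0 by apply: uniq0 => X GX /=; rewrite phij //; exact: jG.
have idE : (idfun : U -> U) =1 phi0.
  by apply: (uniq0 [the {lrmorphism _ -> _} of idfun]).
rewrite -[u]/(idfun u) idE -psiE /=.
by have /asboolP := valP (phi u).
Qed.

End EnvelopingGenerated.

(** 1 and the images of a basis of G span such a set S, as iota is real-linear
    on G. *)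
Lemma enveloping_frame (R : realType) (V : lmodType R) (G : set V)
    (part : bool -> V -> V) (br : V -> V -> V)
    (U : algType R[i]) (iota : V -> U) :
  is_enveloping G part br iota -> subspace G -> finite_dim G ->
  exists S : set U, [/\ finite_dim S, S 1 & generates_alg S].
Proof.
move=> hU sG [m [g [_ defG]]].
pose w (t : option 'I_m) := oapp (iota \o g) 1 t.
have sS := subspace_lspan (range w).
exists (lspan (range w)); split.
- by apply: (subspace_finite_dim_fin (w := w) sS _).1.
- by apply: lspan_incl; exists None.
move=> B algB SB; apply: (enveloping_generated hU algB) => _ [X GX <-].
apply: SB; have [[iotaL _] _] := hU.
have [G0 GL] := sG.
have sW : subspace [set Y | G Y /\ lspan (range w) (iota Y)].
  split=> [|r Y Z [GY SY] [GZ SZ]]; last first.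
    by split; [apply: GL|rewrite iotaL //; apply: sS.2].
  split=> //; have -> : iota 0 = 0; last exact: sS.1.
  by have := iotaL (-1) _ _ G0 G0; rewrite !(scaleN1r, rmorphN1, addNr).
have GW : G `<=` [set Y | G Y /\ lspan (range w) (iota Y)].
  rewrite [X in X `<=` _]defG; apply: lspan_min => // _ [i _ <-]; split.
    by rewrite defG; apply: lspan_incl; exists i.
  by apply: lspan_incl; exists (Some i).
by have [] := GW X GX.
Qed.

(** * The degree filtration and the Fock operators *)

Section Degree.
Variables (n : nat) (K : idomainType).
Local Notation A := (mpoly n K).
Implicit Types f g : A.

Lemma msize_mderiv_le i f : (msize (mderiv i f) <= msize f)%N.
Proof.
rewrite msizeE; apply/bigmax_leqP_seq => m.
rewrite mcoeff_msupp mcoeff_mderiv => fm _.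
have : mnm_add m (mnm1 i) \in msupp f.
  by rewrite mcoeff_msupp; apply: contra_neq fm => ->; rewrite mul0rn.
by move/msize_mdeg_lt; rewrite mdegD mdeg1 addn1; apply: ltnW.
Qed.

Lemma msize_XM_le i f : (msize (mpolyX K (mnm1 i) * f) <= (msize f).+1)%N.
Proof.
have [->|nz_f] := eqVneq f 0; first by rewrite mulr0 msize0.
have nzX : mpolyX K (mnm1 i) != 0.
  by rewrite -(mmeasure_poly_eq0 mdeg) mmeasureX.
by rewrite msizeM // mmeasureX /= mdeg1.
Qed.
End Degree.

Section DegreeFiltration.
Variable R : realType.
Local Notation C := R[i].
Local Notation A := (mpoly 2 C).
Implicit Types p q : spoly R.

(** Superpolynomials whose coefficients all have degree < n (msize is one more
    than the degree).  The odd variables are given degree 0. *)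
Definition spoly_low n : set (spoly R) := [set p |
  let: (f0, f3, f4, f34) := p in
  [&& (msize f0 <= n)%N, (msize f3 <= n)%N, (msize f4 <= n)%N
    & (msize f34 <= n)%N]].

Lemma msize_lin_le n (c : C) (f g : A) : (msize f <= n)%N -> (msize g <= n)%N ->
  (msize (c *: f + g) <= n)%N.
Proof.
move=> fn gn; apply: leq_trans (msizeD_le _ _) _.
by rewrite geq_max gn andbT (leq_trans (msizeZ_le _ _)).
Qed.

Lemma subspace_spoly_low n : subspace (spoly_low n).
Proof.
split=> [|c [[[f0 f3] f4] f34] [[[g0 g3] g4] g34]]; rewrite /spoly_low /=.
  by rewrite msize0.
case/and4P=> f0n f3n f4n f34n /and4P[g0n g3n g4n g34n].
by apply/and4P; split; exact: msize_lin_le.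
Qed.

Lemma spoly_low_inc m n : (m <= n)%N -> spoly_low m `<=` spoly_low n.
Proof.
move=> mn [[[f0 f3] f4] f34]; rewrite /spoly_low /= => /and4P[? ? ? ?].
by apply/and4P; split; apply: leq_trans mn.
Qed.

Lemma spoly_low_exh p : exists n, spoly_low n p.
Proof.
case: p => [[[f0 f3] f4] f34].
exists (maxn (maxn (msize f0) (msize f3)) (maxn (msize f4) (msize f34))).
by rewrite /spoly_low /= !leq_max !leqnn !orbT.
Qed.

Lemma spoly_low_sderiv i n p : spoly_low n p -> spoly_low n (sderiv i p).
Proof.
case: p => [[[f0 f3] f4] f34]; rewrite /spoly_low /sderiv /= => /and4P[? ? ? ?].
by case: (val i) => [|[|[|k]]];
  apply/and4P; split; rewrite ?msizeN ?msize0 //;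
  rewrite (leq_trans (msize_mderiv_le _ _)).
Qed.

Lemma zmulE i (f0 f3 f4 f34 : A) : zmul i (f0, f3, f4, f34) =
  match val i with
  | 0 => let x := mpolyX C (mnm1 ord0) in (x * f0, x * f3, x * f4, x * f34)
  | 1 => let x := mpolyX C (mnm1 ord_max) in (x * f0, x * f3, x * f4, x * f34)
  | 2 => (0, f0, 0, f4)
  | _ => (0, 0, f0, - f3)
  end.
Proof.
by rewrite /zmul /zgen; case: (val i) => [|[|[|k]]] /=; congr (_, _, _, _);
  rewrite ?mul0r ?mul1r ?addr0 ?subr0 ?add0r ?sub0r.
Qed.

Lemma spoly_low_zmul i n p : spoly_low n p -> spoly_low n.+1 (zmul i p).
Proof.
case: p => [[[f0 f3] f4] f34] /and4P[f0n f3n f4n f34n].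
have Xn k f : (msize f <= n)%N -> (msize (mpolyX C (mnm1 k) * f) <= n.+1)%N.
  by move=> fn; apply: leq_trans (msize_XM_le _ _) _.
have z : (msize (0 : A) <= n.+1)%N by rewrite msize0.
rewrite zmulE; case: (val i) => [|[|[|k]]]; apply/and4P; split;
  do ?[exact: Xn|exact: z|exact: leqW]; rewrite msizeN; exact: leqW.
Qed.

Lemma spoly_lowD n p q : spoly_low n p -> spoly_low n q -> spoly_low n (p + q).
Proof. by move=> pn qn; apply: subspaceD pn qn; apply: subspace_spoly_low. Qed.

Lemma spoly_lowZ n c p : spoly_low n p -> spoly_low n (c *: p).
Proof. by move=> pn; apply: subspaceZ pn; apply: subspace_spoly_low. Qed.

Lemma spoly_lowN n p : spoly_low n p -> spoly_low n (- p).
Proof. by rewrite -scaleN1r; apply: spoly_lowZ. Qed.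

Lemma spoly_lowS n p : spoly_low n p -> spoly_low n.+1 p.
Proof. exact: spoly_low_inc. Qed.

Lemma spoly_low_bessel (alpha lambda : R) i n p :
  spoly_low n p -> spoly_low n.+1 (bessel alpha lambda i p).
Proof.
move=> pn; rewrite /bessel; case: (val i) => [|[|[|k]]]; cbv zeta;
  repeat match goal with
  | |- spoly_low _ (_ + _) => apply: spoly_lowD
  | |- spoly_low _ (_ *: _) => apply: spoly_lowZ
  | |- spoly_low _ (- _) => apply: spoly_lowN
  | |- spoly_low _ (zmul _ _) => apply: spoly_low_zmul
  | |- spoly_low _.+1 (sderiv _ _) => apply: spoly_lowS
  | |- spoly_low _ (sderiv _ _) => apply: spoly_low_sderiv
  end; exact: pn.
Qed.

(** Derivatives do not raise the degree, and each term of the operators involves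
    at most one multiplication by a variable. *)
Lemma spoly_low_fock (alpha lambda : R) X n p :
  spoly_low n p -> spoly_low n.+1 (fock alpha lambda X p).
Proof.
move=> pn; have sn := subspace_spoly_low n.+1.
have zvecP a : spoly_low n.+1 (zvec a p).
  by apply: subspace_sum => // i _; apply/spoly_lowZ/spoly_low_zmul.
have besselvP a : spoly_low n.+1 (besselv alpha lambda a p).
  by apply: subspace_sum => // i _; apply/spoly_lowZ/spoly_low_bessel.
have pderP T : spoly_low n.+1 (pder T p).
  apply: subspace_sum => // j _; apply: subspace_sum => // i _.
  exact/spoly_lowZ/spoly_low_zmul/spoly_low_sderiv.
have piLP a : spoly_low n.+1 (piL alpha lambda a p).
  by apply: spoly_lowD; [apply/spoly_lowZ/spoly_lowS|apply: spoly_lowN].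
have zbP c a : spoly_low n.+1 (c *: (zvec a p + besselv alpha lambda a p)).
  by apply/spoly_lowZ/spoly_lowD.
case: X => [[u T] x]; rewrite /fock; apply: spoly_lowD; last first.
  by apply: spoly_lowD => //; apply/spoly_lowN/spoly_lowZ.
apply: spoly_lowD => //; apply: spoly_lowD.
  by apply: spoly_lowD => //; apply: spoly_lowZ.
by apply/spoly_lowZ/spoly_lowD => //; apply: spoly_lowN.
Qed.

End DegreeFiltration.

(** * The filtration modulo the Fock ideal *)

Section Spanning.
Variable R : realType.
Local Notation C := R[i].
Local Notation A := (mpoly 2 C).
Implicit Types (p q : spoly R) (f g : A).

Definition scomp (k : 'I_4) f : spoly R :=
  match val k with
  | 0 => (f, 0, 0, 0)
  | 1 => (0, f, 0, 0)
  | 2 => (0, 0, f, 0)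
  | _ => (0, 0, 0, f)
  end.

Lemma scompP k c f g : scomp k (c *: f + g) = c *: scomp k f + scomp k g.
Proof.
have z : c *: 0 + 0 = 0 :> A by rewrite scaler0 addr0.
rewrite /scomp; case: (val k) => [|[|[|l]]];
  rewrite /GRing.add /= /GRing.scale /=; congr (_, _, _, _); exact/esym.
Qed.

Lemma smul_scomp k f g : smul (f, 0, 0, 0) (scomp k g) = scomp k (f * g).
Proof.
rewrite /scomp; case: (val k) => [|[|[|l]]]; congr (_, _, _, _);
  by rewrite ?mul0r ?mulr0 ?addr0 ?add0r ?subr0 ?oppr0.
Qed.

Lemma spoly_scompE f0 f3 f4 f34 :
  (f0, f3, f4, f34) =
  scomp o1 f0 + scomp o2 f3 + scomp o3 f4 + scomp o4 f34 :> spoly R.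
Proof.
rewrite /scomp /=; congr (_, _, _, _); by rewrite /= !(addr0, add0r).
Qed.

Lemma ord2_neq (i j : 'I_2) : i != j ->
  i = ord0 /\ j = lift ord0 ord0 \/ i = lift ord0 ord0 /\ j = ord0.
Proof.
case: i j => [[|[|//]] lt_i] [[|[|//]] lt_j] // _; [left|right];
  by split; apply: val_inj.
Qed.

(** Stated for any two distinct indices, so that z_1 and z_2 can exchange their
    roles. *)
Lemma mpolyX2E (i j : 'I_2) (m : multinom 2) : i != j ->
  mpolyX C m = mpolyX C (mnm1 i) ^+ m i * mpolyX C (mnm1 j) ^+ m j.
Proof.
move=> /ord2_neq neq_ij; rewrite mpolyXE_id big_ord_recl big_ord1.
by case: neq_ij => -[-> ->]; [reflexivity|apply: mulrC].
Qed.

Lemma mdeg2E (i j : 'I_2) (m : multinom 2) : i != j -> mdeg m = (m i + m j)%N.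
Proof.
move=> /ord2_neq neq_ij; rewrite mdegE big_ord_recl big_ord1.
by case: neq_ij => -[-> ->]; [reflexivity|apply: addnC].
Qed.

Variables alpha lambda : R.
Local Notation cls := (fock_class alpha lambda).

Lemma fock_classP c p q : cls (c *: p + q) = c *: cls p + cls q.
Proof. by rewrite /fock_class lquot_piD lquot_piZ. Qed.

Lemma subspace_fock_class S : subspace S -> subspace (cls @` S).
Proof.
move=> [S0 SL]; split.
  exists 0 => //; have := fock_classP (-1) 0 0.
  by rewrite !scaleN1r !addNr.
move=> c _ _ [p Sp <-] [q Sq <-]; exists (c *: p + q); first exact: SL.
by rewrite fock_classP.
Qed.

Lemma fock_class_eq0 p : p \in fock_ideal alpha lambda -> cls p = 0.
Proof.
move=> pI.
have cls0 : cls 0 = 0.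
  have := fock_classP (-1) 0 0.
  by rewrite !scaleN1r !addNr.
by rewrite -cls0; apply/lquot_piE; rewrite subr0.
Qed.

Lemma fock_gens_mul p q : p \in fock_gens alpha lambda ->
  smul p q \in fock_ideal alpha lambda.
Proof.
move=> gI; apply/asboolP => J idJ gJ; have [_ mulJ] := idJ.
by apply: (mulJ p q _).2; apply: gJ.
Qed.

(** Since z_j ^ 2 is in the ideal, the classes of the monomials with exponent at
    most 1 in z_j span: there are 4 choices for the odd part, 2 for the exponent
    of z_j and n for the exponent of z_i. *)
Lemma fock_filtration_dim (i j : 'I_2) (oj : 'I_4) n :
  i != j -> zgen R oj = (mpolyX C (mnm1 j), 0, 0, 0) ->
  smul (zgen R oj) (zgen R oj) \in fock_gens alpha lambda ->
  finite_dim (cls @` spoly_low (R := R) n) /\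
  (ldim (cls @` spoly_low (R := R) n) <= 8 * n.+1)%N.
Proof.
move=> neq_ij zj gj.
pose w (t : 'I_4 * 'I_2 * 'I_n) : fock_space alpha lambda :=
  cls (scomp t.1.1 (mpolyX C (mnm1 i) ^+ t.2 * mpolyX C (mnm1 j) ^+ t.1.2)).
suff Ww : cls @` spoly_low (R := R) n `<=` lspan (range w).
  have sW := subspace_fock_class (@subspace_spoly_low R n).
  have [fd le8] := subspace_finite_dim_fin sW Ww.
  split=> //; apply: leq_trans le8 _.
  by rewrite !card_prod !card_ord leq_mul2l leqnSn orbT.
have sS := subspace_lspan (range w).
have monoP k (m : multinom 2) : (mdeg m < n)%N ->
    lspan (range w) (cls (scomp k (mpolyX C m))).
  rewrite (mdeg2E m neq_ij) (mpolyX2E m neq_ij) => ltmn.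
  have [ltm2|gem2] := ltnP (m j) 2.
    have ltmi : (m i < n)%N by apply: leq_ltn_trans ltmn; apply: leq_addr.
    by apply: lspan_incl; exists (k, Ordinal ltm2, Ordinal ltmi).
  rewrite fock_class_eq0; first exact: sS.1.
  rewrite -(subnKC gem2) exprD mulrCA expr2 -smul_scomp.
  have -> : (mpolyX C (mnm1 j) * mpolyX C (mnm1 j), 0, 0, 0) =
      smul (zgen R oj) (zgen R oj).
    by rewrite zj /= !(mul0r, mulr0, addr0, subr0).
  exact: fock_gens_mul.
have compP k f : (msize f <= n)%N -> lspan (range w) (cls (scomp k f)).
  move=> fn.
  pose S : set A := [set g | lspan (range w) (cls (scomp k g))].
  have sk : subspace S.
    split=> [|c g h Sg Sh]; rewrite /S /=; last first.
      by rewrite scompP fock_classP; apply: sS.2.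
    rewrite fock_class_eq0; first exact: sS.1.
    have := scompP k (-1) 0 0; rewrite !scaleN1r !addNr => ->.
    exact: rpred0.
  rewrite [f]mpolyE.
  rewrite big_seq_cond; apply: (subspace_sum (W := S)) => // m.
  rewrite andbT => mf; apply: (subspaceZ _ sk); apply: monoP.
  exact: leq_trans (msize_mdeg_lt mf) fn.
move=> _ [[[[f0 f3] f4] f34] /and4P[f0n f3n f4n f34n] <-].
rewrite spoly_scompE /fock_class !lquot_piD.
by do !apply: subspaceD => //; exact: compP.
Qed.

End Spanning.

(** * Restriction of the body to a coordinate axis *)

Section Axis.
Variable R : realType.
Local Notation C := R[i].
Local Notation A := (mpoly 2 C).
Implicit Types (p q : spoly R) (f g : A).

Definition axis (i : 'I_2) f : {poly C} :=
  mmap polyC (fun k => if k == i then 'X else 0) f.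

(** The body of p is its image modulo the odd variables. *)
Definition axis_body (i : 'I_2) p : {poly C} := axis i p.1.1.1.

Lemma axis_bodyP i c p q :
  axis_body i (c *: p + q) = c *: axis_body i p + axis_body i q.
Proof. by rewrite /axis_body /axis mmapD mmapZ mul_polyC. Qed.

Lemma axisM i f g : axis i (f * g) = axis i f * axis i g.
Proof. by rewrite /axis rmorphM. Qed.

Lemma axisX i k : axis i (mpolyX C (mnm1 k)) = if k == i then 'X else 0.
Proof. by rewrite /axis mmapX mmap1U. Qed.

Lemma axis_smul i p q : axis_body i (smul p q) = axis_body i p * axis_body i q.
Proof.
case: p q => [[[f0 f3] f4] f34] [[[g0 g3] g4] g34].
by rewrite /axis_body /= axisM.
Qed.

(** [axis_body] is multiplicative, so its kernel is an ideal. *)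
Lemma axis_ideal i : sideal [set p | axis_body i p = 0].
Proof.
split; last by move=> p q /= p0; rewrite !axis_smul p0 mulr0 mul0r.
split=> [|c p q /= p0 q0] /=; first by rewrite /axis_body /axis mmap0.
by rewrite axis_bodyP p0 q0 scaler0 addr0.
Qed.

Lemma axis_zgen (i : 'I_2) : [/\
  axis_body i (zgen R o1) = (if ord0 == i then 'X else 0),
  axis_body i (zgen R o2) = (if ord_max == i then 'X else 0),
  axis_body i (zgen R o3) = 0 & axis_body i (zgen R o4) = 0].
Proof. by split; rewrite /axis_body /= ?axisX // /axis mmap0. Qed.

Variables alpha lambda : R.
Local Notation cls := (fock_class alpha lambda).

(** The surviving variable z_i, the nilpotent variable z_j, and the two facts
    about the generators of the Fock ideal on which all the rest depends. *)
Lemma fock_axis : alpha != 1 -> lambda = alpha \/ lambda = 1 ->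
  exists (i j : 'I_2) (oi oj : 'I_4),
    [/\ i != j, zgen R oi = (mpolyX C (mnm1 i), 0, 0, 0),
        zgen R oj = (mpolyX C (mnm1 j), 0, 0, 0),
        smul (zgen R oj) (zgen R oj) \in fock_gens alpha lambda
      & forall g : spoly R, g \in fock_gens alpha lambda -> axis_body i g = 0].
Proof.
move=> alpha1.
have vanish4 i (g1 g2 g3 g4 : spoly R) : axis_body i g1 = 0 ->
    axis_body i g2 = 0 -> axis_body i g3 = 0 -> axis_body i g4 = 0 ->
    forall g : spoly R, g \in [:: g1; g2; g3; g4] -> axis_body i g = 0.
  move=> a1 a2 a3 a4 g; rewrite !in_cons.
  by case/or4P=> [/eqP->|/eqP->|/eqP->|]; rewrite // orbF => /eqP->.
case=> ->; rewrite /fock_gens ?eqxx.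
  have [_ a2 a3 _] := axis_zgen ord0.
  have [[_ lin] mul] := axis_ideal ord0.
  exists ord0, ord_max, o1, o2; split; try reflexivity.
    by rewrite in_cons mem_head orbT.
  exact: (vanish4 _ _ _ _ _ (lin _ _ _ (mul _ _ a2).1 (mul _ _ a3).2)
    (mul _ _ a2).2 (mul _ _ a2).2 (mul _ _ a2).2).
rewrite eq_sym (negPf alpha1).
have [a1 _ a3 _] := axis_zgen ord_max.
have [[_ lin] mul] := axis_ideal ord_max.
exists ord_max, ord0, o2, o1; split; try reflexivity.
  by rewrite in_cons mem_head orbT.
exact: (vanish4 _ _ _ _ _ (lin _ _ _ (mul _ _ a1).2 (mul _ _ a3).2)
  (mul _ _ a1).2 (mul _ _ a1).2 (mul _ _ a1).2).
Qed.

Lemma fock_class_axis i p q :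
  (forall g : spoly R, g \in fock_gens alpha lambda -> axis_body i g = 0) ->
  cls p = cls q -> axis_body i p = axis_body i q.
Proof.
move=> gens0 /lquot_piE /asboolP/(_ _ (axis_ideal i)) pq0.
have := pq0 gens0; rewrite /= -scaleN1r addrC axis_bodyP scaleN1r.
by move/eqP; rewrite addrC subr_eq0 => /eqP.
Qed.

(** [axis_body] factors through the quotient and maps these classes to the
    monomials 'X^k. *)
Lemma powers_lfree i oi n :
  (forall g : spoly R, g \in fock_gens alpha lambda -> axis_body i g = 0) ->
  zgen R oi = (mpolyX C (mnm1 i), 0, 0, 0) ->
  lfree (fun k : 'I_n => cls (iter k (zmul oi) (sone R))).
Proof.
move=> gens0 zi c sum0 k.
have axis_pow m : axis_body i (iter m (zmul oi) (sone R)) = 'X^m.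
  elim: m => [|m IH] /=; first by rewrite /axis_body /= /axis mmapC.
  by rewrite /zmul axis_smul IH zi /axis_body /= axisX eqxx exprS.
have cls_sum (r : seq 'I_n) :
    cls (\sum_(m <- r) c m *: iter m (zmul oi) (sone R)) =
    \sum_(m <- r) c m *: cls (iter m (zmul oi) (sone R)).
  elim: r => [|m r IH]; last by rewrite !big_cons fock_classP IH.
  by rewrite !big_nil; apply: fock_class_eq0; apply: rpred0.
have axis_sum (r : seq 'I_n) :
    axis_body i (\sum_(m <- r) c m *: iter m (zmul oi) (sone R)) =
    \sum_(m <- r) c m *: 'X^m.
  elim: r => [|m r IH]; last by rewrite !big_cons axis_bodyP IH axis_pow.
  by rewrite !big_nil /axis_body /axis mmap0.
have cls00 : cls 0 = 0 by apply/fock_class_eq0/rpred0.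
have := fock_class_axis (q := 0) gens0
  (etrans (cls_sum _) (etrans sum0 (esym cls00))).
rewrite axis_sum [RHS]/axis_body /axis mmap0.
move=> /(congr1 (fun p : {poly C} => p`_k)).
rewrite coef0 coef_sum (bigD1 k) //= coefZ coefXn eqxx mulr1.
rewrite big1 ?addr0 // => m neq_mk.
by rewrite coefZ coefXn eq_sym -[_ == _ :> nat]/(m == k) (negPf neq_mk) mulr0.
Qed.
End Axis.

(** * Multiplication operators in the Fock representation *)

Section Multiplication.
Variables (R : realType) (alpha lambda : R).
Local Notation C := R[i].

Lemma jmul0r (a : 'cV[R]_4) : jmul alpha a 0 = 0.
Proof. by rewrite -mul_Lmx mulmx0. Qed.

Lemma jmul_lin c (a a' b : 'cV[R]_4) :
  jmul alpha (c *: a + a') b = c *: jmul alpha a b + jmul alpha a' b.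
Proof.
apply/colP => i; rewrite !mxE /=.
by case: i => [[|[|[|[|//]]]] lt_i] /=; ring.
Qed.

Lemma Lmx_lin c (a a' : 'cV[R]_4) :
  Lmx alpha (c *: a + a') = c *: Lmx alpha a + Lmx alpha a'.
Proof. by apply/matrixP => i j; rewrite [LHS]mxE jmul_lin !mxE. Qed.

Lemma Lmx0 : Lmx alpha 0 = 0.
Proof. by have := Lmx_lin (-1) 0 0; rewrite !scaleN1r !addNr. Qed.

Lemma mpart_lin s c (S T : 'M[R]_4) :
  mpart s (c *: S + T) = c *: mpart s S + mpart s T.
Proof.
by apply/matrixP => i j; rewrite !mxE; case: ifP => // _; rewrite mulr0 addr0.
Qed.

Lemma superderivation_lin c (S T : 'M[R]_4) : superderivation alpha S ->
  superderivation alpha T -> superderivation alpha (c *: S + T).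
Proof.
move=> dS dT s t a b ta; rewrite mpart_lin !mulmxDl -!scalemxAl.
rewrite (dS s t a b ta) (dT s t a b ta).
rewrite jmul_lin -![jmul _ a _]mul_Lmx mulmxDr -scalemxAr.
rewrite !scalerDr !scalerA [c * _]mulrC.
by rewrite !addrA; congr (_ + _); rewrite -!addrA; congr (_ + _); apply: addrC.
Qed.

Lemma superderivation0 : superderivation alpha (0 : 'M[R]_4).
Proof.
move=> s t a b _; have -> : mpart s 0 = 0 :> 'M[R]_4.
  by apply/matrixP => i j; rewrite !mxE if_same.
rewrite !mul0mx jmul0r scaler0 addr0.
by have := jmul_lin (-1) 0 0 b; rewrite !scaleN1r !addNr.
Qed.

(** Needed to extract a finite real basis of the Lie superalgebra. *)
Lemma in_tkk_subspace : subspace (in_tkk alpha).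
Proof.
split.
  exists 0, 0; split; [exact: superderivation0|by rewrite Lmx0 addr0].
move=> c X Y [a [S [dS defX]]] [b [T [dT defY]]].
exists (c *: a + b), (c *: S + T); split; first exact: superderivation_lin.
rewrite /= defX defY Lmx_lin scalerDr -!addrA; congr (_ + _).
by rewrite addrCA.
Qed.

Lemma in_str_Lmx a : in_str alpha (Lmx alpha a).
Proof. by exists a, 0; split; [exact: superderivation0|rewrite addr0]. Qed.

Lemma pder0 p : pder (0 : 'M[R]_4) p = 0.
Proof.
by rewrite /pder big1 // => j _; rewrite big1 // => i _; rewrite mxE scale0r.
Qed.

Lemma zvec0 p : zvec (0 : 'cV[R]_4) p = 0.
Proof. by rewrite /zvec big1 // => i _; rewrite mxE scale0r. Qed.

Lemma besselv0 p : besselv alpha lambda 0 p = 0.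
Proof. by rewrite /besselv big1 // => i _; rewrite mxE scale0r. Qed.

Lemma piL0 p : piL alpha lambda 0 p = 0.
Proof.
by rewrite /piL Lmx0 pder0 /lambdaL !mxE !mulr0 addr0 scale0r subr0.
Qed.

Lemma strL_Lmx a : strL (Lmx alpha a) = a.
Proof. by have := strLK a superderivation0; rewrite addr0. Qed.

Lemma strD_Lmx a : strD alpha (Lmx alpha a) = 0.
Proof. by have := strDK a superderivation0; rewrite addr0. Qed.

Lemma fock_minusE a p :
  fock alpha lambda (a, 0, 0) p = fock_minus alpha lambda a p.
Proof.
rewrite /fock -Lmx0 strL_Lmx strD_Lmx pder0 /fock_L /fock_plus.
by rewrite !zvec0 !besselv0 piL0 !(subr0, addr0, scaler0).
Qed.

Lemma fock_plusE a p :
  fock alpha lambda (0, 0, a) p = fock_plus alpha lambda a p.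
Proof.
rewrite /fock -Lmx0 strL_Lmx strD_Lmx pder0 /fock_L /fock_minus.
by rewrite !zvec0 !besselv0 piL0 !(subr0, addr0, scaler0, add0r).
Qed.

Lemma fock_LE a p :
  fock alpha lambda (0, Lmx alpha a, 0) p = fock_L alpha lambda a p.
Proof.
rewrite /fock strL_Lmx strD_Lmx pder0 /fock_plus /fock_minus.
by rewrite !zvec0 !besselv0 piL0 !(subr0, addr0, scaler0, add0r).
Qed.

Lemma zvec_delta i p : zvec (delta_mx i 0 : 'cV[R]_4) p = zmul i p.
Proof.
rewrite /zvec (bigD1 i) //= mxE !eqxx scale1r big1 ?addr0 // => j /negPf neq.
by rewrite mxE neq /= scale0r.
Qed.

(** In rho(a^-) + rho(a^+) the contributions of pi(L_a) cancel, which leaves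
    - i (z_a + B(z_a)), whereas rho(L_a) = (z_a - B(z_a)) / 2. *)
Lemma zvec_fock a p :
  zvec a p = fock_L alpha lambda a p +
    ('i%C / 2) *: (fock_minus alpha lambda a p + fock_plus alpha lambda a p).
Proof.
rewrite /fock_L /fock_minus /fock_plus.
set z := zvec a p; set b := besselv _ _ _ _; set w := piL _ _ _ _.
have -> : - ('i%C / 2) *: (z + b) + 'i%C *: w
    + (- ('i%C / 2) *: (z + b) - 'i%C *: w) = - 'i%C *: (z + b).
  rewrite addrACA subrr addr0 -scalerDl -opprD; congr (- _ *: _).
  by rewrite -splitr.
rewrite scalerA mulrN mulrAC -expr2 sqr_i mulN1r opprK.
rewrite -scalerDr addrACA addNr addr0 scalerDr -scalerDl.
by rewrite -[2^-1]mul1r -splitr scale1r.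
Qed.

End Multiplication.

Section Fock.
Variables (R : realType) (alpha lambda : R).
Local Notation C := R[i].
Local Notation cls := (fock_class alpha lambda).

Variables (U : algType C) (iota : tkk R -> U).
Variable act : U -> fock_space alpha lambda -> fock_space alpha lambda.
Hypothesis hact : is_module act.
Hypothesis hrho : forall X p, in_tkk alpha X ->
  act (iota X) (cls p) = cls (fock alpha lambda X p).

Lemma zmul_act k : exists u, forall p, act u (cls p) = cls (zmul k p).
Proof.
pose a : 'cV[R]_4 := delta_mx k 0.
have str0 : in_str alpha (0 : 'M[R]_4).
  by rewrite -(Lmx0 alpha); apply: in_str_Lmx.
exists (('i%C / 2) *: (iota (a, 0, 0) + iota (0, 0, a))
  + iota (0, Lmx alpha a, 0)) => p.
rewrite (actDl hact) -[iota (a, 0, 0)]scale1r (actDl hact) scale1r.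
rewrite !hrho //; last exact: in_str_Lmx.
rewrite fock_minusE fock_plusE fock_LE -zvec_delta (zvec_fock alpha lambda).
rewrite -/a.
move: (fock_minus _ _ a p) (fock_plus _ _ a p) (fock_L _ _ a p) => q r l.
by rewrite [l + _]addrC fock_classP /fock_class lquot_piD.
Qed.

Lemma fock_powers x k n : exists u, act u (cls x) = cls (iter n (zmul k) x).
Proof.
have [z zE] := zmul_act k.
elim: n => [|n [u uE]]; first by exists 1; rewrite (act1 hact).
by exists (z * u); rewrite (actM hact) uE zE.
Qed.

End Fock.

(** * The Gelfand-Kirillov dimension *)

Theorem proposition6p7 (R : realType) (alpha lambda : R)
  (halpha0 : alpha != 0) (halpha1 : alpha != 1)
  (hlambda : (lambda = alpha /\ alpha \isn't a Num.nat) \/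
             (lambda = 1 /\ alpha^-1 \isn't a Num.nat))
  (U : algType R[i]) (iota : tkk R -> U)
  (hU : is_enveloping (in_tkk alpha) (@tkk_part R) (tkk_br alpha) iota)
  (act : U -> fock_space alpha lambda -> fock_space alpha lambda)
  (hact : is_module act)
  (hrho : forall X p, in_tkk alpha X ->
     act (iota X) (fock_class alpha lambda p) =
     fock_class alpha lambda (fock alpha lambda X p)) :
  has_GKdim act (range (act^~ (fock_class alpha lambda (sone R)))) (1%:E : \bar R).
Proof.
have lambdaE : lambda = alpha \/ lambda = 1.
  by case: hlambda => -[]; [left|right].
have [i [j [oi [oj [neq_ij zi zj gj gi]]]]] := fock_axis halpha1 lambdaE.
set v := fock_class _ _ _; pose F := range (act^~ v).
have sF : submodule act F := submodule_orbit hact v.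
have infF : ~ finite_dim F.
  move=> [n [w [_ defF]]].
  (* n + 1 independent powers of z_i inside a space of dimension n *)
  suff : (n.+1 <= n)%N by rewrite ltnn.
  apply: (lfree_leq (powers_lfree (n := n.+1) gi zi) (w := w)).
  rewrite -defF => _ [k _ <-].
  have [u uE] := fock_powers hact hrho (sone R) oi k.
  by exists u.
split=> //.
  have sG := in_tkk_subspace alpha.
  have fG := vect_finite_dim (T := ('cV[R]_4 * 'M[R]_4 * 'cV[R]_4)%type) sG.
  have [V [fV V1 genV]] := enveloping_frame hU sG fG.
  exists V, (lspan (range (fun _ : 'I_1 => v))).
  split=> //; first exact: finite_dim_lspan.
  split.
    apply: lspan_min => [|_ [_ _ <-]]; first exact: sF.1.
    by exists 1 => //; apply: (act1 hact).
  move=> N [sN actN] vN _ [u _ <-]; apply/actN/vN/lspan_incl.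
  by exists ord0.
move=> V F0; pose W n := fock_class alpha lambda @` spoly_low (R := R) n.
move=> frame.
refine (@gk_growth_linear R _ _ _ act hact W 8 _ (enveloping_generated hU)
  _ _ _ _ _ V F F0 sF infF frame).
- by move=> n; apply/subspace_fock_class/subspace_spoly_low.
- by move=> m n lemn _ [p pm <-]; exists p => //; apply: spoly_low_inc pm.
- move=> x; rewrite -[x]lquot_reprK; set p := repr _.
  by have [n pn] := spoly_low_exh p; exists n, p.
- by move=> n; apply: fock_filtration_dim neq_ij zj gj.
move=> _ n _ [X GX <-] [p pn <-]; exists (fock alpha lambda X p).
  exact: spoly_low_fock.
by rewrite hrho.
Qed.
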